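(* For every non-negative integer $L$, \begin{align*} \sum_{n\geq 0} q^{\binom{L-2n}{2}} &\frac{(q^3;q^3)_L}{(q;q)_{L-2n}(q^3;q^3)_n} + q^{L+1}\sum_{n\geq 0} q^{\binom{L-2n+1}{2}+n} \frac{(q^3;q^3)_L}{(q;q)_{L-2n}(q^3;q^3)_n}\\ &= \sum_{j\geq 0} q^{\frac{3j^2+j}{2}}\left\{T_{-1}\left(\begin{array}{c}L\\ j \end{array};q^3 \right) +T_{-1}\left(\begin{array}{c}L\\ j+1 \end{array};q^3 \right) \right\},\\ \sum_{n\geq 0} q^{\binom{L-2n}{2}} &\frac{(q^3;q^3)_L}{(q;q)_{L-2n}(q^3;q^3)_n} = \sum_{j\geq 0} q^{\frac{3j^2-j}{2}} T_{1}\left(\begin{array}{c}L\\ j \end{array};q^3 \right),\\ \sum_{n\geq 0} q^{\frac{(L-2n)^2}{2}} &\frac{(q^3;q^3)_L}{(q;q)_{L-2n}(q^3;q^3)_n} = \sum_{j\geq 0} q^{\frac{3j^2+2j}{2}} T_{0}\left(\begin{array}{c}L\\ j \end{array};q^3 \right). \end{align*}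
   Context: Notation: $(a;q)_n=(1-a)(1-aq)\cdots(1-aq^{n-1})$, $(a;q)_\infty=\lim_{n\to\infty}(a;q)_n$, extended to negative $n$ by $(a;q)_n=(a;q)_\infty/(aq^n;q)_\infty$, so $1/(q;q)_n=0$ for $n<0$. The $q$-trinomial coefficient of Andrews–Baxter is $\left(\begin{array}{c}L,\, b\\ a \end{array};q\right)_2 = \sum_{n\geq 0} q^{n(n+b)} \frac{(q;q)_L}{(q;q)_n(q;q)_{n+a}(q;q)_{L-2n-a}}$, and for an integer $n$, $T_n\left(\begin{array}{c}L\\ a\end{array};q\right) = q^{(L(L-n)-a(a-n))/2}\left(\begin{array}{c}L,\, a-n\\ a \end{array};1/q\right)_2$.
   Formalization: The right-hand sums run over all integers j instead of j ≥ 0; as printed the identities fail (first one at L = 0: left side 1+q, right side 1). Here q is nonzero and not a root of unity in any field, with a chosen square root for q^{1/2}. *)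

(* Defs.v *)
From HB Require Import structures.
From mathcomp Require Import all_boot all_order all_algebra.
From mathcomp Require Import mathcomp_extra boolp classical_sets functions.
From mathcomp Require Import cardinality fsbigop.

Set Implicit Arguments.
Unset Strict Implicit.
Unset Printing Implicit Defensive.

Import Order.TTheory GRing.Theory Num.Theory.
Local Open Scope ring_scope.

(* (a; q)_n for n : int.  For m > 0,
     (a; q)_(-m) = (a; q)_oo / (a q^(-m); q)_oo = 1 / (a q^(-m); q)_m,
   and the last expression does not need the infinite product to converge
   (q-trinomials are also used in base 1/q).  For a = q the denominator
   (q^(1-m); q)_m is 0, so that with the field convention 0^-1 = 0 one has
   ((q; q)_(-m))^-1 = 0: see qpoch_neg_inv. *)
Definition qpoch (F : fieldType) (a q : F) (n : int) : F :=
  match n with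
  | Posz m => \prod_(i < m) (1 - a * q ^+ i)
  | Negz m => (\prod_(i < m.+1) (1 - a / q ^+ m.+1 * q ^+ i))^-1
  end.

Lemma qpoch_neg_inv (F : fieldType) (q : F) (n : int) :
  q != 0 -> n < 0 -> (qpoch q q n)^-1 = 0.
Proof.
case: n => // m q_neq0 _; rewrite /= invrK.
rewrite big_ord_recr /= [q ^+ m.+1]exprS invfM mulrA mulfV // mul1r.
by rewrite mulVf ?expf_neq0 // subrr mulr0.
Qed.

(* \sum_(n \in A) is 0 by convention when the support is infinite; here the
   summand vanishes as soon as L - 2n - a < 0, by qpoch_neg_inv. *)
Definition qtrinomial (F : fieldType) (L : nat) (b a : int) (q : F) : F :=
  \sum_(n \in [set: nat])
    q ^ (n%:Z * (n%:Z + b)) *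
    (qpoch q q L%:Z /
     (qpoch q q n%:Z * qpoch q q (n%:Z + a) *
      qpoch q q (L%:Z - 2 * n%:Z - a))).

(* T_n(L, a; q) involves half-integral powers of q.  The parameter r is the
   chosen square root of the base, so the base is r ^+ 2 and q^(m/2) is r ^ m. *)
Definition qT (F : fieldType) (n : int) (L : nat) (a : int) (r : F) : F :=
  r ^ (L%:Z * (L%:Z - n) - a * (a - n)) *
  qtrinomial L (a - n) a (r ^+ 2)^-1.

Definition binz2 (m : int) : int := ((m * (m - 1)) %/ 2)%Z.

(* Main.v *)
(* With u_n = 1/(Q; Q)_n and Q = q^3, reversing the base gives
     T_n(L, a; Q) = (Q; Q)_L \sum_k Q^(m(m-n)/2) u_k u_(k+a) u_m,  m = L - 2k - a,
   so \sum_L t^L/(Q; Q)_L \sum_j Q^(j^2/2) z^j T_n(L, j; Q) is the product of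
   (-t Q^((1-n)/2); Q)_oo and
     \sum_(i, k) t^(i+k) Q^((k-i)^2/2) z^(k-i) u_i u_k
       = (-t z Q^(1/2); Q)_oo (-t z^(-1) Q^(1/2); Q)_oo / (t^2; Q)_oo,
   the last equality being a q-Vandermonde summation.  For z a suitable power of
   q^(1/2) the three products in base Q are the residue classes mod 3 of a single
   product in base q, and (-a t; q)_oo / (t^2; Q)_oo is the generating function of
   the left-hand sides.  The first identity combines two values of z. *)
Require Import Defs.
From HB Require Import structures.
From mathcomp Require Import all_boot all_order all_algebra.
From mathcomp Require Import mathcomp_extra boolp classical_sets functions.
From mathcomp Require Import cardinality fsbigop.
From mathcomp Require Import ring zify.

Set Implicit Arguments.
Unset Strict Implicit.
Unset Printing Implicit Defensive.

Import Order.TTheory GRing.Theory Num.Theory.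
Local Open Scope ring_scope.

(** * Formal power series *)

(** A separate name for [nat -> R], so that multiplication can be convolution rather than
    pointwise. *)
Definition fps (R : Type) := nat -> R.

Section FormalPowerSeries.
Variable R : comNzRingType.

HB.instance Definition _ := GRing.Zmodule.copy (fps R) (nat -> R).

Implicit Types f g h : fps R.

Definition fps_mul f g : fps R := fun n => \sum_(i < n.+1) f i * g (n - i)%N.
Definition fpsC (c : R) : fps R := fun n => if n is 0%N then c else 0.
Definition fpsX : fps R := fun n => (n == 1%N)%:R.

(** Truncation beyond degree n does not affect the coefficient of t^n, so the ring laws are
    inherited from polynomials. *)
Lemma fps_mul_poly f g N n :
  (n < N)%N -> fps_mul f g n = (\poly_(i < N) f i * \poly_(i < N) g i)`_n.
Proof.
move=> ltnN; rewrite coefM; apply: eq_bigr => i _.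
rewrite !coef_poly (leq_ltn_trans _ ltnN) ?leq_ord //.
by rewrite (leq_ltn_trans (leq_subr _ _) ltnN).
Qed.

Lemma fps_mulC : commutative fps_mul.
Proof. by move=> f g; apply/funext => n; rewrite !(fps_mul_poly _ _ (ltnSn n)) mulrC. Qed.

Lemma fps_mulA : associative fps_mul.
Proof.
move=> f g h; apply/funext => n.
transitivity (\poly_(i < n.+1) f i * (\poly_(i < n.+1) g i * \poly_(i < n.+1) h i))`_n.
  rewrite coefM; apply: eq_bigr => i _.
  by rewrite coef_poly ltn_ord -fps_mul_poly // ltnS leq_subr.
rewrite mulrA coefM; apply: eq_bigr => i _.
by rewrite coef_poly ltnS leq_subr -fps_mul_poly // ltn_ord.
Qed.

Lemma fps_mulC1 c f n : fps_mul (fpsC c) f n = c * f n.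
Proof. by rewrite /fps_mul big_ord_recl subn0 big1 ?addr0 // => i _; rewrite mul0r. Qed.

Lemma fps_mul1 : left_id (fpsC 1) fps_mul.
Proof. by move=> f; apply/funext => n; rewrite fps_mulC1 mul1r. Qed.

Lemma fps_mulDl : left_distributive fps_mul +%R.
Proof.
move=> f g h; apply/funext => n.
by rewrite /fps_mul [RHS]/GRing.add/= -big_split /=; apply: eq_bigr => i _; rewrite mulrDl.
Qed.

Lemma fps_one_neq0 : fpsC 1 != 0 :> fps R.
Proof. by apply/eqP => /(congr1 (@^~ 0%N))/eqP; rewrite oner_eq0. Qed.

HB.instance Definition _ :=
  GRing.Zmodule_isComNzRing.Build (fps R) fps_mulA fps_mulC fps_mul1 fps_mulDl fps_one_neq0.

Lemma fpsDE f g n : (f + g) n = f n + g n. Proof. by []. Qed.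
Lemma fpsBE f g n : (f - g) n = f n - g n. Proof. by []. Qed.
Lemma fpsME f g n : (f * g) n = \sum_(i < n.+1) f i * g (n - i)%N. Proof. by []. Qed.
Lemma fpsCM c f n : (fpsC c * f) n = c * f n. Proof. exact: fps_mulC1. Qed.
Lemma fpsXM f n : (fpsX * f) n = if n is m.+1 then f m else 0.
Proof.
rewrite fpsME; case: n => [|n]; first by rewrite big_ord1 mul0r.
rewrite big_ord_recl big_ord_recl /= mul0r add0r mul1r /bump /= subn1 big1 ?addr0 // => i _.
by rewrite mul0r.
Qed.

(** The substitution of c t for t, in which q-difference equations are written. *)
Definition dilate (c : R) f : fps R := fun n => c ^+ n * f n.

Lemma dilateM c f g : dilate c (f * g) = dilate c f * dilate c g.
Proof.
apply/funext => n; rewrite /dilate !fpsME big_distrr /=; apply: eq_bigr => i _.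
by rewrite mulrACA -exprD subnKC // -ltnS.
Qed.

(** The series \sum_n d_n t^(2n); for d_n = 1/(Q; Q)_n it is 1/(t^2; Q)_oo, by Euler. *)
Definition evenfps (d : nat -> R) : fps R := fun n => if odd n then 0 else d n./2.

Lemma sum_even (f : nat -> R) N :
  \sum_(i < N) (if odd i then 0 else f i) = \sum_(n < uphalf N) f n.*2.
Proof.
elim: N => [|N IH]; first by rewrite !big_ord0.
rewrite big_ord_recr {}IH /=.
have [k [->|->]] : exists k, N = k.*2 \/ N = k.*2.+1 by exists N./2; lia.
  by rewrite odd_double uphalf_double doubleK big_ord_recr.
by rewrite /= odd_double doubleK uphalf_double addr0.
Qed.

Lemma evenfpsM (d : nat -> R) f n :
  (evenfps d * f) n = \sum_(i < n./2.+1) d i * f (n - i.*2)%N.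
Proof.
transitivity (\sum_(i < n./2.+1) (fun i => d i./2 * f (n - i)%N) i.*2); last first.
  by apply: eq_bigr => i _; rewrite doubleK.
rewrite -[RHS](sum_even (fun i => d i./2 * f (n - i)%N) n.+1) fpsME /evenfps.
by apply: eq_bigr => i _; case: odd; rewrite ?mul0r.
Qed.
End FormalPowerSeries.

(** * The series (-a t; q)_oo *)

Section QExponential.
Variable F : fieldType.

(* Vanishes for n < 0, so that iqpoch_pred holds for every integer n. *)
Definition iqpoch (q : F) (n : int) : F := (qpoch q q n)^-1.

Definition non_root_of_unity (q : F) := forall k : nat, (0 < k)%N -> q ^+ k != 1.

Lemma iqpoch0 q : iqpoch q 0 = 1.
Proof. by rewrite /iqpoch /= big_ord0 invr1. Qed.

Lemma iqpoch_neg q (n : int) : q != 0 -> n < 0 -> iqpoch q n = 0.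
Proof. exact: qpoch_neg_inv. Qed.

Lemma iqpoch_pred q n : q != 0 -> non_root_of_unity q ->
  iqpoch q (n - 1) = (1 - q ^ n) * iqpoch q n.
Proof.
move=> q0 hq; case: (ltrP n 0) => hn; first by rewrite !iqpoch_neg ?mulr0 //; lia.
(* At n = 0 the left side vanishes by [iqpoch_neg] and the right side by the factor 1 - q^0. *)
case: n hn => [[|n]|//] _; first by rewrite iqpoch_neg // expr0z subrr mul0r.
have -> : n.+1%:Z - 1 = n by lia.
have h : 1 - q ^+ n.+1 != 0 by rewrite subr_eq0 eq_sym hq.
by rewrite /iqpoch /= big_ord_recr /= -exprS invfM mulrCA mulfV ?mulr1.
Qed.

(* The coefficients of (-a t; q)_oo, by Euler. *)
Definition qexp (q a : F) : fps F := fun n => a ^+ n * q ^+ 'C(n, 2) * iqpoch q n.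

(** The first factor of (-a t; q)_oo is split off; on coefficients this is Pascal's rule for C(n+1,
    2) together with [iqpoch_pred]. *)
Lemma qexp_shift q a : q != 0 -> non_root_of_unity q ->
  qexp q a = (1 + fpsC a * fpsX F) * qexp q (a * q).
Proof.
move=> q0 hq; apply/funext => n; rewrite mulrDl mul1r -mulrA fpsDE fpsCM fpsXM /qexp.
case: n => [|n]; first by rewrite mulr0 addr0 !expr0.
have <- : n.+1%:Z - 1 = n by lia.
rewrite iqpoch_pred // binS bin1 -exprnP !exprMn exprD !exprS; ring.
Qed.

Lemma dilate_qexp q a c : dilate c (qexp q a) = qexp q (a * c).
Proof. by apply/funext => n; rewrite /dilate /qexp exprMn !mulrA (mulrC (c ^+ n)). Qed.

(** Comparing coefficients of t^(n+1) gives (1 - q^(n+1)) f_(n+1) = a q^n f_n, so the constant term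
    determines the series. *)
Lemma qdifference_unique (q a : F) (f g : fps F) : non_root_of_unity q ->
  f = (1 + fpsC a * fpsX F) * dilate q f -> g = (1 + fpsC a * fpsX F) * dilate q g ->
  f 0%N = g 0%N -> f = g.
Proof.
move=> hq hf hg h0; apply/funext; elim=> // n IH.
have rec h : h = (1 + fpsC a * fpsX F) * dilate q h ->
    h n.+1 = (1 - q ^+ n.+1)^-1 * (a * q ^+ n * h n).
  move=> /(congr1 (@^~ n.+1)); rewrite mulrDl mul1r -mulrA fpsDE fpsCM fpsXM /dilate => /= e.
  have h1 : 1 - q ^+ n.+1 != 0 by rewrite subr_eq0 eq_sym hq.
  apply: (mulfI h1); rewrite mulrA mulfV // mul1r mulrBl mul1r {1}e; ring.
by rewrite (rec f) // (rec g) // IH.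
Qed.

Lemma qexp_at0 q a : qexp q a 0%N = 1.
Proof. by rewrite /qexp !expr0 !mul1r iqpoch0. Qed.

Lemma non_root_of_unityX q m : (0 < m)%N -> non_root_of_unity q -> non_root_of_unity (q ^+ m).
Proof. by move=> m0 hq k k0; rewrite -exprM hq // muln_gt0 m0. Qed.

(* Both sides satisfy f(t) = (1 + a t) f(q t). *)
Lemma qexp_triple q a : q != 0 -> non_root_of_unity q ->
  qexp q a = qexp (q ^+ 3) a * qexp (q ^+ 3) (a * q) * qexp (q ^+ 3) (a * q ^+ 2).
Proof.
move=> q0 hq; have hQ := non_root_of_unityX (isT : 0 < 3)%N hq.
have Q0 : q ^+ 3 != 0 by rewrite expf_neq0.
apply: (qdifference_unique (a := a) hq).
- by rewrite dilate_qexp -qexp_shift.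
(* Dilation by q turns the parameters a, a q, a q^2 into a q, a q^2, a q^3; the factor 1 + a t then
   restores a from a q^3. *)
- have -> : a * q ^+ 2 = a * q * q by ring.
  rewrite !dilateM !dilate_qexp {1}(qexp_shift a Q0 hQ).
  have -> : a * q ^+ 3 = a * q * q * q by ring.
  ring.
- by rewrite !fpsME !big_ord1 !fpsME !big_ord1 !qexp_at0 !mulr1.
Qed.

(* Induction on N for all j at once, from 1 - q^N = (1 - q^(N-b)) + q^(N-b) (1 - q^b). *)
Lemma qVandermonde q (N : nat) (j : int) : q != 0 -> non_root_of_unity q ->
  \sum_(b < N.+1) q ^ (b%:Z * (b%:Z + j)) *
    (iqpoch q b * iqpoch q (b%:Z + j) * iqpoch q (N - b)%N) =
  iqpoch q N * iqpoch q (N%:Z + j).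
Proof.
move=> q0 hq; elim: N j => [|N IH] j.
  by rewrite big_ord1 /= mul0r expr0z !iqpoch0 mul1r mulr1 mul1r.
have hN : 1 - q ^+ N.+1 != 0 by rewrite subr_eq0 eq_sym hq.
apply: (mulfI hN).
have S1 : N.+1%:Z - 1 = N by lia.
(* With u_n = 1/(q; q)_n, this uses u_(N+1+j) = u_(N+j) + q^(N+1+j) u_(N+1+j); the two terms are the
   induction hypotheses at j and at j + 1. *)
have -> : (1 - q ^+ N.+1) * (iqpoch q N.+1 * iqpoch q (N.+1%:Z + j)) =
   iqpoch q N * iqpoch q (N%:Z + j) +
   q ^ (N.+1%:Z + j) * (iqpoch q N * iqpoch q (N%:Z + (j + 1))).
  have -> : N%:Z + j = N.+1%:Z + j - 1 by lia.
  have -> : N%:Z + (j + 1) = N.+1%:Z + j by lia.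
  rewrite -S1 !iqpoch_pred // -exprnP; ring.
rewrite -!IH !big_distrr /=.
transitivity (\sum_(b < N.+2) (q ^ (b%:Z * (b%:Z + j)) *
    (iqpoch q b * iqpoch q (b%:Z + j) * iqpoch q (N.+1%:Z - b%:Z - 1))) +
  \sum_(b < N.+2) q ^ (b%:Z * (b%:Z + j) + (N.+1%:Z - b%:Z)) *
    (iqpoch q (b%:Z - 1) * iqpoch q (b%:Z + j) * iqpoch q (N.+1 - b)%N)).
  rewrite -big_split /=; apply: eq_bigr => b _.
  have -> : (N.+1 - b)%N = N.+1%:Z - b%:Z :> int by rewrite -subzn // -ltnS.
  have -> : q ^+ N.+1 = q ^ (N.+1%:Z - b%:Z) * q ^ b%:Z.
    by rewrite -expfzDr // subrK.
  rewrite !iqpoch_pred // (expfzDr (b%:Z * (b%:Z + j))) //; ring.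
(* The term b = N + 1 of the first sum and the term b = 0 of the second contain [iqpoch] at -1 and
   vanish; shifting b in the second sum turns j into j + 1. *)
congr (_ + _).
  rewrite big_ord_recr /= subrr (iqpoch_neg (n := 0 - 1)) // !mulr0 addr0; apply: eq_bigr => b _.
  have -> // : N.+1%:Z - b%:Z - 1 = (N - b)%N by have := ltn_ord b; lia.
rewrite big_ord_recl /= (iqpoch_neg (n := 0 - 1)) // !mul0r mulr0 add0r; apply: eq_bigr => b _.
rewrite /bump leq0n add1n subSS mulrA -expfzDr //.
have -> : b.+1%:Z - 1 = b by lia.
have -> : b.+1%:Z + j = b%:Z + (j + 1) by lia.
congr (q ^ _ * _); nia.
Qed.

End QExponential.

(** * The theta sum and q-trinomial generating functions *)

Section Theta.
Variable F : fieldType.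

Lemma sum_ord_widen (f : nat -> F) (m n : nat) : (m <= n)%N ->
  (forall i, (m <= i)%N -> f i = 0) -> \sum_(i < m) f i = \sum_(i < n) f i.
Proof.
move=> lemn f0; rewrite (big_ord_widen _ f lemn) big_mkcond /=.
by apply: eq_bigr => i _; case: ltnP => // /f0.
Qed.

Lemma sum_triangle (G : nat -> nat -> F) N :
  \sum_(i < N) \sum_(b < i.+1) G (i - b)%N b = \sum_(b < N) \sum_(n < N - b) G n b.
Proof.
elim: N => [|N IH]; first by rewrite !big_ord0.
rewrite big_ord_recr {}IH /=.
under [RHS]eq_bigr => b _ do rewrite (subSn (ltn_ord b : b <= N)%N) big_ord_recr /=.
by rewrite big_split /= [X in X + _ = _](_ : _ = \sum_(i < N.+1) \sum_(n < N - i) G n i) //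
  big_ord_recr /= subnn big_ord0 addr0.
Qed.

Lemma sqrn_bin2 n : (n ^ 2 = n + 2 * 'C(n, 2))%N.
Proof. by elim: n => // n IH; rewrite binS bin1; lia. Qed.

Lemma qexp_square (s z : F) n :
  qexp (s ^+ 2) (s * z) n = s ^+ (n ^ 2)%N * z ^+ n * iqpoch (s ^+ 2) n.
Proof.
by rewrite sqrn_bin2 /qexp exprMn exprD [s ^+ (2 * _)]exprM; ring.
Qed.

(* The series \sum_(i, k) t^(i+k) s^((k-i)^2) z^(k-i) u_i u_k in base s^2. *)
Definition theta (s z : F) : fps F := fun M => \sum_(i < M.+1)
  s ^ ((M%:Z - 2 * i%:Z) ^+ 2) * z ^ (M%:Z - 2 * i%:Z) *
  (iqpoch (s ^+ 2) i * iqpoch (s ^+ 2) (M%:Z - i%:Z)).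

(** With j = M - 2i, [qVandermonde] expands u_i u_(i+j) as a sum over b. Since j^2 + 2b(b+j) = b^2 +
    (b+j)^2, the indices n = i - b, b and c = b + j separate into the three factors. *)
Lemma theta_factor (s z : F) : s != 0 -> z != 0 -> non_root_of_unity (s ^+ 2) ->
  theta s z =
  evenfps (fun n => iqpoch (s ^+ 2) n) * (qexp (s ^+ 2) (s / z) * qexp (s ^+ 2) (s * z)).
Proof.
move=> s0 z0 hQ; have Q0 : s ^+ 2 != 0 by rewrite expf_neq0.
apply/funext => M.
pose a (n b : nat) : int := M%:Z - 2 * n%:Z - b%:Z.
pose G n b := s ^ (a n b ^+ 2 + b%:Z ^+ 2) * z ^ (a n b - b%:Z) *
  (iqpoch (s ^+ 2) b * iqpoch (s ^+ 2) (a n b) * iqpoch (s ^+ 2) n).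
(* Here [a n b] is the third index c; terms with c < 0 vanish, so triangular ranges can be widened
   to a square and narrowed again. *)
have G0 n b : (M < n.*2 + b)%N -> G n b = 0.
  by move=> h; rewrite /G (iqpoch_neg (n := a n b)) ?mulr0 ?mul0r ?mulr0 // /a; lia.
transitivity (\sum_(n < M.+1) \sum_(b < M.+1) G n b).
  transitivity (\sum_(i < M.+1) \sum_(b < i.+1) G (i - b)%N b).
    apply: eq_bigr => i _.
    have -> : M%:Z - i%:Z = i%:Z + (M%:Z - 2 * i%:Z) by lia.
    rewrite -qVandermonde // big_distrr /=; apply: eq_bigr => b _; rewrite /G.
    have lebi : (b <= i)%N by rewrite -ltnS.
    have -> : a (i - b)%N b = b%:Z + (M%:Z - 2 * i%:Z) by rewrite /a -subzn //; lia.
    move: (M%:Z - 2 * i%:Z) => j.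
    have -> : b%:Z + j - b%:Z = j by lia.
    have -> : (b%:Z + j) ^+ 2 + b%:Z ^+ 2 = j ^+ 2 + 2 * (b%:Z * (b%:Z + j)) by ring.
    rewrite expfzDr // (exprnP s 2) (exprz_exp s 2); ring.
  rewrite sum_triangle exchange_big /=; apply: eq_bigr => b _.
  by apply: (@sum_ord_widen (G ^~ b)) => [|n h]; [exact: leq_subr | apply: G0; lia].
rewrite evenfpsM.
transitivity (\sum_(n < M./2.+1) \sum_(b < M.+1) G n b).
  apply/esym; apply: (@sum_ord_widen (fun n => \sum_(b < M.+1) G n b)) => [|n hn]; first by lia.
  by rewrite big1 // => b _; apply: G0; lia.
apply: eq_bigr => n _; have hn : (n.*2 <= M)%N by have := ltn_ord n; lia.
rewrite fpsME big_distrr /=.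
rewrite -(@sum_ord_widen (G n) (M - n.*2).+1) => [||b hb]; [|lia|by apply: G0; lia].
apply: eq_bigr => b _; have hb : (b <= M - n.*2)%N by rewrite -ltnS.
rewrite !qexp_square /G.
have -> : a n b = (M - n.*2 - b)%N by rewrite /a; lia.
move: (M - n.*2 - b)%N => c.
have -> : c%:Z ^+ 2 + b%:Z ^+ 2 = (c ^ 2 + b ^ 2)%N by lia.
have -> : z ^ (c%:Z - b%:Z) = z ^+ c * z^-1 ^+ b by rewrite expfzDr // exprVn -exprnN.
rewrite -exprnP exprD; ring.
Qed.

(** In product form, (1 - t^2)/(t^2; Q)_oo = 1/(Q t^2; Q)_oo. *)
Lemma evenfps_diff (Q : F) : Q != 0 -> non_root_of_unity Q ->
  (1 - fpsX F ^+ 2) * evenfps (fun n => iqpoch Q n) = evenfps (fun n => Q ^+ n * iqpoch Q n).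
Proof.
move=> Q0 hQ; apply/funext => n; rewrite mulrBl mul1r expr2 -mulrA.
rewrite fpsBE !fpsXM.
case: n => [|[|n]]; rewrite ?fpsXM /evenfps ?subr0 ?expr0 ?mul1r //= negbK.
case: odd; first by rewrite subr0.
have <- : n./2.+1%:Z - 1 = n./2 by lia.
rewrite iqpoch_pred // -exprnP; ring.
Qed.
End Theta.

(** * Base reversal and generating functions of the q-trinomials *)

Section QTrinomialSums.
Variable F : fieldType.

Lemma fsum_nat (G : nat -> F) N : (forall n, (N <= n)%N -> G n = 0) ->
  \sum_(n \in [set: nat]) G n = \sum_(n < N) G n.
Proof.
move=> G0; rewrite fsbig_ord; apply/esym/fsbig_widen => // n [_ /= hn].
by apply: G0; rewrite leqNgt; apply/negP.
Qed.

Lemma fsum_int (G : int -> F) (c : int) N :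
  (forall x, ~~ (c <= x < c + N%:Z) -> G x = 0) ->
  \sum_(x \in [set: int]) G x = \sum_(i < N) G (c + i%:Z).
Proof.
move=> G0; rewrite (fsbig_ord _ _ (fun i => G (c + i%:Z))).
rewrite -(@fsbig_image _ _ _ _ _ `I_N (fun i : nat => c + i%:Z) G); last first.
  by move=> i j _ _ /addrI [].
apply/esym/fsbig_widen => // x [_ /= hx]; apply: G0; apply/negP => hc; apply: hx.
by exists (absz (x - c)); rewrite /=; lia.
Qed.

(** Each factor satisfies 1 - Q^(-k) = -Q^(-k) (1 - Q^k) with Q = s^2, and Q^(1+...+x) =
    s^(x(x+1)). *)
Lemma iqpoch_inv (s : F) (x : nat) : s != 0 ->
  iqpoch (s ^+ 2)^-1 x = (-1) ^+ x * s ^+ (x * x.+1) * iqpoch (s ^+ 2) x.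
Proof.
move=> s0; have Q0 : s ^+ 2 != 0 by rewrite expf_neq0.
elim: x => [|x IH]; first by rewrite !iqpoch0 !mulr1.
have rec Q : iqpoch Q x.+1 = iqpoch Q x * (1 - Q ^+ x.+1)^-1 :> F.
  by rewrite /iqpoch /= big_ord_recr /= -exprS invfM.
rewrite !rec {}IH exprVn.
have -> : 1 - ((s ^+ 2) ^+ x.+1)^-1 = - ((s ^+ 2) ^+ x.+1)^-1 * (1 - (s ^+ 2) ^+ x.+1).
  by rewrite mulNr mulrBr mulr1 mulVf ?expf_neq0 // opprB.
rewrite invfM invrN invrK.
have -> : (x.+1 * x.+2 = x * x.+1 + 2 * x.+1)%N by lia.
rewrite [s ^+ (_ + _)]exprD [s ^+ (2 * _)]exprM (exprS (-1)); ring.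
Qed.

(** After base reversal the signs cancel because k + (k+j) + m = L, and the powers of s collect to
    s^(m(m-n)). *)
Lemma qT_term (s : F) (n : int) (L k : nat) (j : int) :
  s != 0 -> non_root_of_unity (s ^+ 2) ->
  let m := L%:Z - 2 * k%:Z - j in
  s ^ (L%:Z * (L%:Z - n) - j * (j - n)) *
  ((s ^+ 2)^-1 ^ (k%:Z * (k%:Z + (j - n))) *
    (qpoch (s ^+ 2)^-1 (s ^+ 2)^-1 L%:Z /
     (qpoch (s ^+ 2)^-1 (s ^+ 2)^-1 k%:Z * qpoch (s ^+ 2)^-1 (s ^+ 2)^-1 (k%:Z + j) *
      qpoch (s ^+ 2)^-1 (s ^+ 2)^-1 m))) =
  qpoch (s ^+ 2) (s ^+ 2) L * (s ^ (m * (m - n)) *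
    (iqpoch (s ^+ 2) k * iqpoch (s ^+ 2) (k%:Z + j) * iqpoch (s ^+ 2) m)).
Proof.
move=> s0 hQ m; have Q0 : s ^+ 2 != 0 by rewrite expf_neq0.
have [t et] : {t | t = (s ^+ 2)^-1} by exists (s ^+ 2)^-1.
have t0 : t != 0 by rewrite et invr_eq0.
have fold Q x : (qpoch Q Q x)^-1 = iqpoch Q x :> F by [].
rewrite -et !invfM !fold.
(* A negative index makes both sides 0; otherwise [iqpoch_inv] applies to every factor. *)
case: (ltrP (k%:Z + j) 0) => [hp|hp].
  by rewrite !(iqpoch_neg (n := k%:Z + j)) //; ring.
case: (ltrP m 0) => [hm|hm].
  by rewrite !(iqpoch_neg (n := m)) //; ring.
case em : m hm => [m'|//] _; case ep : (k%:Z + j) hp => [p|//] _.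
have tE (x : nat) : iqpoch t x = (-1) ^+ x * s ^+ (x * x.+1) * iqpoch (s ^+ 2) x.
  by rewrite et iqpoch_inv.
rewrite -[qpoch t _ _]invrK fold !tE !invfM invr_sign.
rewrite -[qpoch (s ^+ 2) _ _]invrK fold.
have hL : L = (k + p + m')%N by move: em ep; rewrite /m; lia.
have sg : (-1) ^+ L * ((-1) ^+ k * (-1) ^+ p * (-1) ^+ m') = 1 :> F.
  by rewrite -!exprD -hL -signr_odd oddD addbb.
have pw : s ^ (L%:Z * (L%:Z - n) - j * (j - n)) * t ^ (k%:Z * (k%:Z + (j - n))) *
    (s ^+ (L * L.+1))^-1 * (s ^+ (k * k.+1) * s ^+ (p * p.+1) * s ^+ (m' * m'.+1)) =
    s ^ (m'%:Z * (m'%:Z - n)).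
  rewrite et (exprnN s 2) exprz_exp exprnN -!exprD exprnP -!expfzDr //.
  have -> : j = p%:Z - k%:Z by lia.
  congr (s ^ _); rewrite hL; nia.
rewrite -pw; move: ((-1) ^+ L) ((-1) ^+ k) ((-1) ^+ p) ((-1) ^+ m') sg => e1 e2 e3 e4 sg.
rewrite -[RHS]mul1r -sg; ring.
Qed.

Lemma qT_sum (s : F) (n : int) (L : nat) (j : int) :
  s != 0 -> non_root_of_unity (s ^+ 2) ->
  qT n L j s = qpoch (s ^+ 2) (s ^+ 2) L * \sum_(k < L.+1)
    (let m := L%:Z - 2 * k%:Z - j in s ^ (m * (m - n)) *
    (iqpoch (s ^+ 2) k * iqpoch (s ^+ 2) (k%:Z + j) * iqpoch (s ^+ 2) m)).
Proof.
move=> s0 hQ; have Q0 : s ^+ 2 != 0 by rewrite expf_neq0.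
rewrite /qT /qtrinomial mulr_fsumr.
under eq_fsbigr => k _ do rewrite qT_term //.
rewrite -mulr_fsumr; congr (_ * _); apply: fsum_nat => k hk.
case: (ltrP (k%:Z + j) 0) => hp; first by rewrite (iqpoch_neg (n := k%:Z + j)) //; ring.
by rewrite (iqpoch_neg (n := L%:Z - 2 * k%:Z - j)) //; [ring | lia].
Qed.

Lemma qT_eq0 (s : F) (n : int) (L : nat) (j : int) :
  s != 0 -> non_root_of_unity (s ^+ 2) -> ~~ (- L%:Z <= j < - L%:Z + (2 * L).+1%:Z) ->
  qT n L j s = 0.
Proof.
move=> s0 hQ hj; have Q0 : s ^+ 2 != 0 by rewrite expf_neq0.
rewrite qT_sum // big1 ?mulr0 // => k _ /=.
case: (ltrP (k%:Z + j) 0) => hp; first by rewrite (iqpoch_neg (n := k%:Z + j)) //; ring.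
by rewrite (iqpoch_neg (n := L%:Z - 2 * k%:Z - j)) //; [ring | lia].
Qed.

(** Replacing j by m = L - 2k - j isolates s^(m(m-n)) u_m, a coefficient of [qexp]; the sum over k
    that remains is the coefficient of t^(L-m) in [theta]. *)
Lemma theta_qT_sum (s z : F) (n : int) (L : nat) :
  s != 0 -> non_root_of_unity (s ^+ 2) ->
  \sum_(j \in [set: int]) s ^ (j ^+ 2) * z ^ j * qT n L j s =
  qpoch (s ^+ 2) (s ^+ 2) L * (qexp (s ^+ 2) (s ^ (1 - n)) * theta s z) L.
Proof.
move=> s0 hQ; have Q0 : s ^+ 2 != 0 by rewrite expf_neq0.
pose H j k := let m := L%:Z - 2 * k%:Z - j in s ^ (j ^+ 2) * z ^ j * (s ^ (m * (m - n)) *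
    (iqpoch (s ^+ 2) k * iqpoch (s ^+ 2) (k%:Z + j) * iqpoch (s ^+ 2) m)).
have H0 j k : (k%:Z + j < 0) || (L%:Z - 2 * k%:Z - j < 0) -> H j k = 0.
  rewrite /H /=; case/orP => h; first by rewrite (iqpoch_neg (n := k%:Z + j)) //; ring.
  by rewrite (iqpoch_neg (n := L%:Z - 2 * k%:Z - j)) //; ring.
rewrite (@fsum_int _ (- L%:Z) (2 * L).+1); last by move=> x hx; rewrite qT_eq0 // mulr0.
transitivity (qpoch (s ^+ 2) (s ^+ 2) L *
    \sum_(k < L.+1) \sum_(i < (2 * L).+1) H (- L%:Z + i%:Z) k).
  rewrite exchange_big /= big_distrr /=; apply: eq_bigr => i _.
  rewrite qT_sum // mulrCA; congr (_ * _); rewrite big_distrr /=.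
  by apply: eq_bigr.
congr (_ * _).
transitivity (\sum_(k < L.+1) \sum_(m < L.+1) H (L%:Z - 2 * k%:Z - m%:Z) k).
  apply: eq_bigr => k _.
  rewrite -(@fsum_int (H ^~ k)); last by move=> j hj; apply: H0; lia.
  rewrite (@reindex_fsbigT _ _ _ _ _ (fun m => L%:Z - 2 * k%:Z - m)); last first.
    by exists (fun m => L%:Z - 2 * k%:Z - m) => x; lia.
  rewrite (@fsum_int _ 0 L.+1) => [|m hm]; last by apply: H0; lia.
  by apply: eq_bigr => i _; rewrite add0r.
rewrite exchange_big fpsME /=; apply: eq_bigr => m _; rewrite /theta big_distrr /=.
have hm : (m <= L)%N by rewrite -ltnS.
rewrite -(@sum_ord_widen _ (fun k => H (L%:Z - 2 * k%:Z - m%:Z) k) (L - m).+1) => [||k hk].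
- apply: eq_bigr => k _; rewrite /H /=.
  have -> : (L - m)%N = L%:Z - m%:Z :> int by lia.
  have -> : L%:Z - 2 * k%:Z - m%:Z = L%:Z - m%:Z - 2 * k%:Z by lia.
  have -> : k%:Z + (L%:Z - m%:Z - 2 * k%:Z) = L%:Z - m%:Z - k%:Z by lia.
  have -> : L%:Z - 2 * k%:Z - (L%:Z - m%:Z - 2 * k%:Z) = m by lia.
  have -> : qexp (s ^+ 2) (s ^ (1 - n)) m = s ^ (m%:Z * (m%:Z - n)) * iqpoch (s ^+ 2) m.
    rewrite /qexp -exprM (exprnP s (2 * _)) (exprnP (s ^ _)) exprz_exp -expfzDr //.
    by congr (s ^ _ * _); have := sqrn_bin2 m; nia.
  ring.
- lia.
- by apply: H0; lia.
Qed.

End QTrinomialSums.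

(** * Specialization to bases q and q^3 *)

Section Specialization.
Variable F : fieldType.

Lemma fsum_evenfps (G : nat -> F) (A : F) (d : nat -> F) (f : fps F) (L : nat) :
  (forall n, (n.*2 <= L)%N -> G n = A * (d n * f (L - n.*2)%N)) ->
  (forall n, (L < n.*2)%N -> G n = 0) ->
  \sum_(n \in [set: nat]) G n = A * (evenfps d * f) L.
Proof.
move=> hG G0; rewrite (@fsum_nat _ _ L./2.+1) => [|n hn]; last by apply: G0; lia.
rewrite evenfpsM big_distrr /=; apply: eq_bigr => n _; apply: hG.
by have := ltn_ord n; lia.
Qed.

Lemma binz2_nat (n : nat) : binz2 n = 'C(n, 2).
Proof.
have := sqrn_bin2 n => h; rewrite /binz2.
have -> : n%:Z * (n%:Z - 1) = 'C(n, 2)%:Z * 2 by lia.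
by rewrite mulzK.
Qed.

Lemma fpsCM_eq1 (c : F) : c != 0 -> fpsC c * fpsC c^-1 = 1.
Proof.
by move=> c0; apply/funext => -[|n]; rewrite fpsCM /= ?mulfV ?mulr0.
Qed.

(* Divided by (-t q^2; q)_oo / (t^2; q^3)_oo, both sides equal (1 + q) (1 + t). *)
Lemma first_identity_series (q : F) : q != 0 -> non_root_of_unity q ->
  let D := evenfps (fun n => iqpoch (q ^+ 3) n) in
  D * qexp q 1 + evenfps (fun n => (q ^+ 3) ^+ n * iqpoch (q ^+ 3) n) *
    (fpsC q * qexp q (q ^+ 2)) =
  qexp (q ^+ 3) (q ^+ 3) * (D * (qexp (q ^+ 3) q * qexp (q ^+ 3) (q ^+ 2))) +
  fpsC q * (qexp (q ^+ 3) (q ^+ 3) * (D * (qexp (q ^+ 3) (q ^+ 4) * qexp (q ^+ 3) q^-1))).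
Proof.
move=> q0 hq D; have hQ := non_root_of_unityX (isT : 0 < 3)%N hq.
have Q0 : q ^+ 3 != 0 by rewrite expf_neq0.
rewrite -evenfps_diff // -/D.
(* Everything is reduced to the base-q^3 series with parameters q^2, q^3 and q^4. *)
rewrite (qexp_shift 1 q0 hq) mul1r (qexp_shift q q0 hq) -expr2 (qexp_triple (q ^+ 2) q0 hq).
rewrite -exprSr -exprD.
rewrite (qexp_shift q Q0 hQ) -exprS (qexp_shift q^-1 Q0 hQ).
have -> : q^-1 * q ^+ 3 = q ^+ 2 by field.
have cc := fpsCM_eq1 q0; have -> : fpsC 1 = 1 :> fps F by [].
(* With the series as ring variables, the two sides agree only modulo c c' = 1. *)
move: (fpsC q) (fpsC q^-1) cc (fpsX F) (qexp _ (q ^+ 2)) (qexp _ (q ^+ 3)) (qexp _ (q ^+ 4)) D.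
move=> c c' cc X e2 e3 e4 D; apply/eqP; rewrite -subr_eq0; apply/eqP.
transitivity ((1 - c * c') * (X * D * e2 * e3 * e4)); first by ring.
by rewrite cc subrr mul0r.
Qed.

End Specialization.

(** The sums on the right run over all integers j: at L = 0 the first left-hand side is 1 + q, and
    its q comes from j = -1. *)
Theorem theorem3p2 (F : fieldType) (q r : F)
    (hr : r ^+ 2 = q) (hq0 : q != 0)
    (hq : forall k : nat, (0 < k)%N -> q ^+ k != 1) (L : nat) :
  [/\ \sum_(n \in [set: nat])
        q ^ binz2 (L%:Z - 2 * n%:Z) *
        (qpoch (q ^+ 3) (q ^+ 3) L%:Z /
         (qpoch q q (L%:Z - 2 * n%:Z) * qpoch (q ^+ 3) (q ^+ 3) n%:Z))
      + q ^+ L.+1 *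
        \sum_(n \in [set: nat])
          q ^ (binz2 (L%:Z - 2 * n%:Z + 1) + n%:Z) *
          (qpoch (q ^+ 3) (q ^+ 3) L%:Z /
           (qpoch q q (L%:Z - 2 * n%:Z) * qpoch (q ^+ 3) (q ^+ 3) n%:Z))
      = \sum_(j \in [set: int])
          r ^ (3 * j ^+ 2 + j) *
          (qT (-1) L j (r ^+ 3) + qT (-1) L (j + 1) (r ^+ 3)),

      \sum_(n \in [set: nat])
        q ^ binz2 (L%:Z - 2 * n%:Z) *
        (qpoch (q ^+ 3) (q ^+ 3) L%:Z /
         (qpoch q q (L%:Z - 2 * n%:Z) * qpoch (q ^+ 3) (q ^+ 3) n%:Z))
      = \sum_(j \in [set: int])
          r ^ (3 * j ^+ 2 - j) * qT 1 L j (r ^+ 3)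

    & \sum_(n \in [set: nat])
        r ^ ((L%:Z - 2 * n%:Z) ^+ 2) *
        (qpoch (q ^+ 3) (q ^+ 3) L%:Z /
         (qpoch q q (L%:Z - 2 * n%:Z) * qpoch (q ^+ 3) (q ^+ 3) n%:Z))
      = \sum_(j \in [set: int])
          r ^ (3 * j ^+ 2 + 2 * j) * qT 0 L j (r ^+ 3)].
Proof.
have r0 : r != 0 by move: hq0; rewrite -hr expf_eq0.
have s0 : r ^+ 3 != 0 by rewrite expf_neq0.
have sQ : (r ^+ 3) ^+ 2 = q ^+ 3 by rewrite -hr -!exprM.
have hs : non_root_of_unity ((r ^+ 3) ^+ 2).
  by rewrite sQ; apply: non_root_of_unityX.
have fold Q x : (qpoch Q Q x)^-1 = iqpoch Q x :> F by [].
have rexp (k j : int) : r ^ (3 * j ^+ 2 + k * j) = (r ^+ 3) ^ (j ^+ 2) * (r ^ k) ^ j.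
  by rewrite expfzDr // (exprnP r 3) !exprz_exp.
(* Taking s = r^3 and z = r^k gives base-q^3 products with parameters r^(3(1-n)), r^(3-k) and
   r^(3+k). *)
have qTsum (k n : int) : \sum_(j \in [set: int]) r ^ (3 * j ^+ 2 + k * j) * qT n L j (r ^+ 3) =
    qpoch (q ^+ 3) (q ^+ 3) L * (qexp (q ^+ 3) ((r ^+ 3) ^ (1 - n)) *
      (evenfps (fun i => iqpoch (q ^+ 3) i) *
        (qexp (q ^+ 3) (r ^ (3 - k)) * qexp (q ^+ 3) (r ^ (3 + k))))) L.
  under eq_fsbigr => j _ do rewrite rexp.
  rewrite theta_qT_sum // theta_factor ?expfz_neq0 // sQ.
  by rewrite (expfzDr 3 k) // (expfzDr 3 (- k)) // invr_expz.
have lhs (w : int -> F) :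
    \sum_(n \in [set: nat]) w (L%:Z - 2 * n%:Z) * (qpoch (q ^+ 3) (q ^+ 3) L%:Z /
         (qpoch q q (L%:Z - 2 * n%:Z) * qpoch (q ^+ 3) (q ^+ 3) n%:Z)) =
    qpoch (q ^+ 3) (q ^+ 3) L *
      (evenfps (fun i => iqpoch (q ^+ 3) i) * ((fun m => w m%:Z * iqpoch q m) : fps F)) L.
  apply: fsum_evenfps => n hn; rewrite invfM !fold.
    have -> : L%:Z - 2 * n%:Z = (L - n.*2)%N by lia.
    ring.
  by rewrite (iqpoch_neg (n := L%:Z - 2 * n%:Z)) //; [ring | lia].
have binE : (fun m : nat => q ^ binz2 m * iqpoch q m) = qexp q 1.
  by apply/funext => m; rewrite binz2_nat /qexp expr1n mul1r.
split.
- rewrite (lhs (fun m => q ^ binz2 m)) binE mulr_fsumr.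
  (* With L = m + 2n, the weight q^(L+1) q^(C(m+1,2)+n) equals q^(3n) q q^(2m) q^C(m,2). *)
  rewrite (@fsum_evenfps _ _ (qpoch (q ^+ 3) (q ^+ 3) L)
     (fun n => (q ^+ 3) ^+ n * iqpoch (q ^+ 3) n) (fpsC q * qexp q (q ^+ 2)) L); first last.
  + move=> n hn; rewrite invfM !fold (iqpoch_neg (n := L%:Z - 2 * n%:Z)) //; [ring | lia].
  + move=> n hn; rewrite invfM !fold fpsCM /qexp; set m := (L - n.*2)%N.
    have -> : L%:Z - 2 * n%:Z = m by rewrite /m; lia.
    have -> : m%:Z + 1 = m.+1 by lia.
    rewrite binz2_nat; have -> : q ^ ('C(m.+1, 2)%:Z + n%:Z) = q ^+ ('C(m, 2) + m + n).
      by rewrite binS bin1 -exprnP.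
    have -> : L = (m + n.*2)%N by rewrite /m; lia.
    rewrite -addnn; move: m 'C(m, 2) (qpoch _ _ _) => m' c A.
    have pw : q ^+ (m' + (n + n)).+1 * q ^+ (c + m' + n) =
        (q ^+ 3) ^+ n * (q * ((q ^+ 2) ^+ m' * q ^+ c)).
      by rewrite -!exprM -exprD -exprD -exprS -!exprD; congr (q ^+ _); lia.
    transitivity (q ^+ (m' + (n + n)).+1 * q ^+ (c + m' + n) * A * iqpoch q m' *
      iqpoch (q ^+ 3) n); [ring | rewrite pw; ring].
  (* Shifting j + 1 to j gives 3(j-1)^2 + (j-1) = 3j^2 - 5j + 2, hence k = -5 and the factor r^2 =
     q. *)
  have -> : \sum_(j \in [set: int]) r ^ (3 * j ^+ 2 + j) *
          (qT (-1) L j (r ^+ 3) + qT (-1) L (j + 1) (r ^+ 3)) =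
      \sum_(j \in [set: int]) r ^ (3 * j ^+ 2 + 1 * j) * qT (-1) L j (r ^+ 3) +
      q * \sum_(j \in [set: int]) r ^ (3 * j ^+ 2 + (-5) * j) * qT (-1) L j (r ^+ 3).
    rewrite mulr_fsumr.
    rewrite [X in _ = _ + X](@reindex_fsbigT _ _ _ _ _ (fun j => j + 1)); last first.
      by exists (fun j => j - 1) => j; lia.
    (* The 2L + 2 integers from -L - 1 to L cover the supports of both T at j and T at j + 1. *)
    rewrite !(@fsum_int _ _ (- L%:Z - 1) (2 * L).+2); last 3 first.
    + by move=> j hj; rewrite qT_eq0 ?mulr0 //; lia.
    + by move=> j hj; rewrite qT_eq0 ?mulr0 //; lia.
    + by move=> j hj; rewrite !qT_eq0 ?addr0 ?mulr0 //; lia.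
    rewrite -big_split /=; apply: eq_bigr => i _; move: (- L%:Z - 1 + i%:Z) => j.
    rewrite mulrDr mul1r [q * (_ * _)]mulrA; congr (_ + _ * _).
    by rewrite -hr (exprnP r 2) -expfzDr //; congr (r ^ _); ring.
  rewrite !qTsum [q * (_ * _)]mulrCA -!mulrDr; congr (_ * _).
  move: (first_identity_series hq0 hq) => /(congr1 (@^~ L)); rewrite /= fpsDE fpsDE fpsCM => ->.
  have -> : (r ^+ 3) ^ (1 - -1) = q ^+ 3 := sQ.
  have -> : r ^ (3 - 1) = q := hr.
  have -> : r ^ (3 + 1) = q ^+ 2 by rewrite -hr -exprM.
  have -> : r ^ (3 - -5) = q ^+ 4 by rewrite -hr -exprM.
  by have -> : r ^ (3 + -5) = q^-1 by rewrite -hr.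
- under [RHS]eq_fsbigr => j _ do rewrite -[j in X in _ - X]mul1r -mulNr.
  rewrite qTsum (lhs (fun m => q ^ binz2 m)) binE; congr (_ * _).
  (* The parameters 1, q, q^2 are the three residue classes of [qexp q 1]. *)
  rewrite (qexp_triple _ hq0 hq) !mul1r subrr expr0z.
  have -> : r ^ (3 - -1) = q ^+ 2 by rewrite -hr -exprM.
  have -> : r ^ (3 + -1) = q := hr.
  have AC (a b c d : fps F) : d * (a * b * c) = a * (d * (c * b)) by ring.
  by rewrite AC.
- rewrite qTsum (lhs (fun m => r ^ (m ^+ 2))); congr (_ * _).
  have -> : (fun m : nat => r ^ (m%:Z ^+ 2) * iqpoch q m) = qexp q r.
    apply/funext => m; have := qexp_square r 1 m; rewrite mulr1 hr expr1n mulr1 => ->.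
    by congr (_ * _); rewrite exprnP; congr (r ^ _); lia.
  (* Here n = 0 and k = 2 give r^3, r, r^5, the classes r q, r, r q^2 of [qexp q r]. *)
  rewrite (qexp_triple _ hq0 hq) subr0.
  have AC (a b c d : fps F) : d * (a * b * c) = b * (d * (a * c)) by ring.
  have -> : (r ^+ 3) ^ 1 = r * q by rewrite -hr -exprS.
  have -> : r ^ (3 - 2) = r by [].
  have -> : r ^ (3 + 2) = r * q ^+ 2 by rewrite -hr -exprM -exprS.
  by rewrite AC.
Qed.
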